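(* Let $\lambda\in\mathbb{R}$ and let $k\ge 0$, $n\ge k$ be integers. Let $X_1,\ldots,X_k$ be independent random variables, each having the gamma distribution with parameters $\alpha=1,\lambda=1$ (i.e. exponential with density $e^{-x}$ for $x\ge0$), and let $U_1,\ldots,U_k$ be independent random variables uniformly distributed on $(0,1)$, with $X_i$ and $U_j$ independent for all $i,j$ (all $2k$ variables mutually independent). Then \[ S_{1,\lambda}(n,k)=(-\lambda)^{n-k}\binom{n}{k}\, E\big[(U_1X_1+U_2X_2+\cdots+U_kX_k)^{n-k}\big]. \]
   Context: The degenerate Stirling numbers of the first kind $S_{1,\lambda}(n,k)$ are defined by the generating function $\frac{1}{k!}\big(\log(1+\lambda t)^{1/\lambda}\big)^k=\sum_{n=k}^\infty S_{1,\lambda}(n,k)\frac{t^n}{n!}$ (for $\lambda\neq 0$; with $\log(1+\lambda t)^{1/\lambda}$ read as $t$ when $\lambda=0$); equivalently, $(x)_{n,\lambda}=\sum_{l=0}^n S_{1,\lambda}(n,l)x^l$, where $(x)_{0,\lambda}=1$ and $(x)_{n,\lambda}=x(x-\lambda)\cdots(x-(n-1)\lambda)$. The convention $0^0=1$ is used. *)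

(* Defs.v *)
From HB Require Import structures.
From mathcomp Require Import all_boot all_order all_algebra.
From mathcomp Require Import all_classical all_reals all_analysis.

Set Implicit Arguments.
Unset Strict Implicit.
Unset Printing Implicit Defensive.

Import Order.TTheory GRing.Theory Num.Theory.
Import numFieldNormedType.Exports.

Local Open Scope classical_set_scope.
Local Open Scope ring_scope.

(* The case lambda = 0 is the limit of the other one as lambda tends to 0. *)
Definition degenerate_log (R : realType) (lambda t : R) : R :=
  if lambda == 0 then t else ln ((1 + lambda * t) `^ lambda^-1).

(* Equality of the two sides of
     (1 / k!) (log (1 + lambda t)^(1/lambda))^k = \sum_(n >= k) a n t^n / n!
   as functions of t on a neighbourhood of 0, with a extended by 0 below k. *)
Definition degenerate_stirling1_egf (R : realType) (lambda : R) (k : nat)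
    (a : nat -> R) : Prop :=
  (forall n, (n < k)%N -> a n = 0) /\
  \forall t \near (0 : R),
    (fun N => \sum_(k <= n < N) a n * (t ^+ n / n`!%:R)) @ \oo -->
    (k`!%:R)^-1 * degenerate_log lambda t ^+ k.

(* S_{1,lambda}(n, k).  The sequence selected by xget is unique, by uniqueness
   of power series expansions; the default value fun=> 0 is never used, since
   the left-hand side of the generating function is analytic at t = 0. *)
Definition degenerate_stirling1 (R : realType) (lambda : R) (n k : nat) : R :=
  xget (fun=> 0) [set a | degenerate_stirling1_egf lambda k a] n.

Definition mutually_independent (d : measure_display) (T : measurableType d)
    (R : realType) (P : probability T R) (I : finType)
    (Z : I -> {RV P >-> R}) : Prop :=
  forall (J : {set I}) (A : I -> set R), (forall i, measurable (A i)) ->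
    P (\bigcap_(i in [set` J]) (Z i @^-1` A i)) =
    (\prod_(i in J) P (Z i @^-1` A i))%E.

Definition has_law (d : measure_display) (T : measurableType d)
    (R : realType) (P : probability T R) (X : {RV P >-> R})
    (mu : set R -> \bar R) : Prop :=
  forall A : set R, measurable A -> distribution P X A = mu A.

(* Main.v *)
(** Both sides are read off the power series L(x) = \sum_j x^j / (j+1).

    On the one hand log (1 + lambda t) ^ (1/lambda) = t L(- lambda t), also
    for lambda = 0, so that S_{1,lambda}(n, k) is
    (- lambda)^(n-k) n!/k! times the coefficient of x^(n-k) in L(x)^k.

    On the other hand E[(U X)^j] = j! / (j+1), i.e. L is the exponential
    generating function of the moments of U X; by independence the one of
    U_1 X_1 + ... + U_k X_k is L^k, so its m-th moment is m! times the
    coefficient of x^m in L(x)^k. *)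

Require Import Defs.
From HB Require Import structures.
From mathcomp Require Import all_boot all_order all_algebra.
From mathcomp Require Import all_classical all_reals all_analysis.
From mathcomp Require Import measurable_realfun.
From mathcomp Require Import ring lra.

Import Order.TTheory GRing.Theory Num.Theory.
Import numFieldNormedType.Exports.

Local Open Scope classical_set_scope.
Local Open Scope ring_scope.

(** * Products of absolutely convergent series *)

Definition cauchy_product {R : pzRingType} (a b : nat -> R) (n : nat) : R :=
  \sum_(j < n.+1) a (n - j)%N * b j.

(** The left side sums [a i * b j] over the triangle [i + j < n]; for a fixed [j] the index [i] runs
    below [n - j]. The induction adds one antidiagonal at a time. *)
Lemma series_cauchy_product (R : realType) (a b : nat -> R) (n : nat) :
  series (cauchy_product a b) n = \sum_(j < n) series a (n - j)%N * b j.
Proof.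
elim: n => [|n IH]; first by rewrite seriesEord/= !big_ord0.
rewrite seriesSr IH /cauchy_product [RHS]big_ord_recr [X in _ + X]big_ord_recr /=.
rewrite addrA -big_split/= !subnn subSnn; congr (_ + _).
  apply: eq_bigr => j _; rewrite subSn ?(ltnW (ltn_ord j))//.
  by rewrite seriesSr mulrDl.
by rewrite seriesSr seriesEord/= big_ord0 add0r.
Qed.

Lemma cauchy_product_norm_le (R : realType) (a b : nat -> R) (n : nat) :
  `|cauchy_product a b n| <= cauchy_product (fun i => `|a i|) (fun i => `|b i|) n.
Proof.
by apply: le_trans (ler_norm_sum _ _ _) _; apply: ler_sum => j _; rewrite normrM.
Qed.

Section Mertens.
Variables (R : realType) (a b : nat -> R).
Hypotheses (cvg_a : cvgn [normed series a]) (cvg_b : cvgn [normed series b]).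

Let A : nat -> R := series (fun i => `|a i|).
Let B : nat -> R := series (fun i => `|b i|).
Let C : nat -> R := series (cauchy_product (fun i => `|a i|) (fun i => `|b i|)).

Let nd_norm (u : nat -> R) : nondecreasing_seq (series (fun i => `|u i| : R)).
Proof. by apply: nondecreasing_series => n _ _ /=. Qed.

Let norm_ge0 (u : nat -> R) n : 0 <= series (fun i => `|u i|) n.
Proof. by rewrite seriesEord/= sumr_ge0. Qed.

Let B_sum n : B n = \sum_(j < n) `|b j|.
Proof. by rewrite /B seriesEord. Qed.

(** For absolute values, the triangle [i + j < n] lies inside the square of side [n] and, for
    [C_ge], contains the square of side [n./2]. This squeezes [C] between two sequences with the
    limit of [A * B]. *)
Let C_le n : C n <= A n * B n.
Proof.
rewrite /C series_cauchy_product B_sum mulr_sumr. apply: ler_sum => j _.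
by rewrite ler_wpM2r//= nd_norm// leq_subr.
Qed.

Let C_ge n : A n./2 * B n./2 <= C n.
Proof.
have hn : (n./2 <= n)%N by rewrite -{2}(odd_double_half n) -addnn addnA leq_addl.
rewrite /C series_cauchy_product B_sum mulr_sumr.
rewrite (big_ord_widen n (fun j => A n./2 * `|b j|))//.
rewrite [leRHS](bigID (fun j : 'I_n => (j < n./2)%N))/= -[leLHS]addr0 lerD//.
  apply: ler_sum => j jn; rewrite ler_wpM2r//= nd_norm//.
  rewrite leq_subRL; last exact: ltnW.
  rewrite (leq_trans (leq_add (ltnW jn) (leqnn _)))//.
  by rewrite addnn -{2}(odd_double_half n) leq_addl.
by apply: sumr_ge0 => j _; rewrite mulr_ge0//= norm_ge0.
Qed.

Let cvg_half (u : nat -> R) (l : R) :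
  u n @[n --> \oo] --> l -> u n./2 @[n --> \oo] --> l.
Proof.
move=> ul; apply: (cvg_comp _ _ _ ul) => D [N _ ND]; exists N.*2 => // n /= Nn.
by apply: ND => /=; rewrite -(doubleK N) half_leq.
Qed.

Let cvg_AB : A n * B n @[n --> \oo] --> limn A * limn B.
Proof. exact: cvgM. Qed.

Let cvg_C : C n @[n --> \oo] --> limn A * limn B.
Proof.
apply: (squeeze_cvgr _ (cvg_half _ _ cvg_AB) cvg_AB).
by near=> n; rewrite C_le C_ge.
Unshelve. all: end_near. Qed.

Lemma is_cvg_normed_cauchy_product : cvgn [normed series (cauchy_product a b)].
Proof.
apply: (@series_le_cvg R _
  (cauchy_product (fun i => `|a i|) (fun i => `|b i|)) _ _ _ (cvgP _ cvg_C)).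
- by move=> n; exact: normr_ge0.
- by move=> n; apply: sumr_ge0 => j _; rewrite mulr_ge0/=.
- exact: cauchy_product_norm_le.
Qed.

(** The partial sums of the Cauchy product miss exactly the terms [a i * b j] of the square with
    [i + j >= n]. In absolute value these add up to at most [A n * B n - C n], which tends to 0. *)
Lemma cvg_cauchy_product (la lb : R) :
  series a @ \oo --> la -> series b @ \oo --> lb ->
  series (cauchy_product a b) @ \oo --> la * lb.
Proof.
move=> al bl.
have abl : series a n * series b n @[n --> \oo] --> la * lb by exact: cvgM.
suff D0 : series (cauchy_product a b) n - series a n * series b n
          @[n --> \oo] --> 0.
  rewrite -[la * lb]add0r; apply: cvg_trans (cvgD D0 abl).
  by apply: near_eq_cvg; near=> n; rewrite /= subrK.
have ABC0 : A n * B n - C n @[n --> \oo] --> 0.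
  by rewrite -(subrr (limn A * limn B)); apply: cvgB.
apply/norm_cvg0P; apply: (squeeze_cvgr _ (cvg_cst 0) ABC0); near=> n.
rewrite normr_ge0/= /C !series_cauchy_product B_sum.
have -> : series b n = \sum_(j < n) b j by rewrite seriesEord.
rewrite !mulr_sumr -!sumrB.
apply: le_trans (ler_norm_sum _ _ _) _; apply: ler_sum => j _.
rewrite -!mulrBl normrM ler_wpM2r//= distrC.
have jn : (n - j <= n)%N by rewrite leq_subr.
rewrite /A !sub_series_geq//.
exact: ler_norm_sum.
Unshelve. all: end_near. Qed.

End Mertens.

(** * The generating function *)

(** Mean value theorem between 0 and x for the remainder [g]: it vanishes at 0, and its derivative
    [- y^n / (1 - y)] is at most [2 |x|^n] in absolute value when [|y| <= |x| <= 1/2]. *)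
Lemma norm_ln1B_sub_taylor (R : realType) (x : R) (n : nat) : `|x| <= 2^-1 ->
  `|ln (1 - x) + \sum_(j < n) x ^+ j.+1 / j.+1%:R| <= 2 * `|x| ^+ n.+1.
Proof.
move=> xhalf.
pose g (y : R) : R := ln (1 - y) + \sum_(j < n) y ^+ j.+1 / j.+1%:R.
pose dg (y : R) : R := - (y ^+ n / (1 - y)).
have gD (y : R) : `|y| <= `|x| -> is_derive y 1 g (dg y).
  move=> yx; have y1 : 0 < 1 - y.
    by have := ler_norm y; lra.
  have ln1B : is_derive y 1 (fun z : R => ln (1 - z)) (- (1 - y)^-1).
    have h1 : is_derive y 1 (fun z : R => 1 - z) (-1).
      rewrite (_ : (fun z : R => 1 - z) = cst 1 - id)//.
      by apply: is_derive_eq; rewrite add0r.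
    have h2 := is_derive1_ln y1.
    rewrite -[X in is_derive _ _ _ X]mulrN1.
    have h3 := @is_derive1_comp R (@ln R) (fun z : R => 1 - z) y _ _ h2 h1.
    exact: h3.
  have term (j : 'I_n) : is_derive y 1 (fun z : R => z ^+ j.+1 / j.+1%:R) (y ^+ j).
    have -> : (fun z : R => z ^+ j.+1 / j.+1%:R) =
        (j.+1%:R^-1 : R) *: (@idfun R ^+ j.+1).
      by apply/funext => z; rewrite scalrfctE exprfctE /= [RHS]mulrC.
    apply: is_derive_eq; rewrite /GRing.scale/= mulr1 mulrA mulVf ?mul1r//.
  have -> : g = (fun z : R => ln (1 - z)) +
      (\sum_(j < n) (fun z : R => z ^+ j.+1 / j.+1%:R)).
    by apply/funext => z; rewrite /g /= [RHS]/GRing.add/= fct_sumE.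
  apply: is_derive_eq; rewrite /dg.
  have y1n : 1 - y != 0 by rewrite gt_eqF.
  (* After multiplication by [1 - y] the claim is the finite geometric sum formula. *)
  apply: (mulIf y1n); rewrite mulrDl !mulNr mulVf// divfK//.
  have -> : y ^+ n = 1 + (y - 1) * \sum_(i < n) y ^+ i by rewrite -subrX1; ring.
  by ring.
have g0 : g 0 = 0.
  by rewrite /g subr0 ln1 add0r big1// => j _; rewrite expr0n/= mul0r.
have gC (a b : R) : (forall y, y \in `[a, b] -> `|y| <= `|x|) ->
    {within `[a, b], continuous g}.
  move=> h; apply: derivable_within_continuous => y yab.
  by apply: ex_derive; apply: gD; exact: h.
have dgb (y : R) : `|y| <= `|x| -> `|dg y * x| <= 2 * `|x| ^+ n.+1.
  move=> yx; rewrite normrM /dg normrN normrM exprSr mulrA ler_wpM2r//.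
  rewrite mulrC ler_pM//.
    rewrite normfV -[leRHS]invrK lef_pV2 ?posrE ?invr_gt0//; last first.
      by rewrite normr_gt0; have := ler_norm y; lra.
    by have := ler_norm (1 - y); have := ler_norm y; lra.
  by rewrite normrX lerXn2r.
rewrite -/(g x).
have [x0|x0] := leP 0 x.
  have inx (y : R) : y \in `[0, x] -> `|y| <= `|x|.
    by rewrite in_itv/= => /andP[y0 yx]; rewrite !ger0_norm.
  have [||c cx] := @MVT_segment R g dg 0 x x0.
  - by move=> y yx; apply: gD; apply: inx; exact: subset_itv_oo_cc.
  - exact: gC.
  by rewrite g0 !subr0 => ->; apply: dgb; exact: inx.
have inx (y : R) : y \in `[x, 0] -> `|y| <= `|x|.
  by rewrite in_itv/= => /andP[y0 yx]; rewrite !ler0_norm ?lerN2// ltW.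
have [||c cx] := @MVT_segment R g dg x 0 (ltW x0).
- by move=> y yx; apply: gD; apply: inx; exact: subset_itv_oo_cc.
- exact: gC.
rewrite g0 !sub0r => /eqP; rewrite mulrN eqr_opp => /eqP ->.
by apply: dgb; exact: inx.
Qed.

(* The value at 0 is the limit of - ln (1 - x) / x. *)
Definition neg_ln1B_div {R : realType} (x : R) : R :=
  if x == 0 then 1 else - ln (1 - x) / x.

Lemma is_cvg_normed_series_geometric_div (R : realType) (x : R) :
  `|x| < 1 -> cvgn [normed series (fun j => x ^+ j / j.+1%:R)].
Proof.
move=> x1; apply: (@series_le_cvg R _ (geometric 1 `|x|)).
- by move=> n; exact: normr_ge0.
- by move=> n; rewrite /geometric/= mul1r exprn_ge0.
- move=> n; rewrite /geometric/= mul1r normrM normrX ler_piMr ?exprn_ge0//.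
  by rewrite normfV ger0_norm// invf_le1// ler1n.
- by apply: is_cvg_geometric_series; rewrite normr_id.
Qed.

Lemma cvg_series_geometric_div (R : realType) (x : R) : `|x| <= 2^-1 ->
  series (fun j => x ^+ j / j.+1%:R) @ \oo --> neg_ln1B_div x.
Proof.
move=> xhalf; rewrite /neg_ln1B_div; case: eqP => [->|/eqP x0].
  (* At x = 0 every partial sum with at least one term is 1, since 0^0 = 1; the shift skips the
     empty sum. *)
  rewrite -(cvg_shiftn 1); apply: cvg_near_cst; near=> n.
  rewrite /= addn1 seriesEord/= big_ord_recl/= expr0 divr1 big1 ?addr0//.
  by move=> i _; rewrite expr0n/= mul0r.
have pow0 : 2 * `|x| ^+ n @[n --> \oo] --> 0.
  have -> : (fun n => 2 * `|x| ^+ n) = geometric 2 `|x| by [].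
  by apply: cvg_geometric; rewrite normr_id; lra.
apply/cvgrPdist_le => e e0.
have : \forall n \near \oo, `|0 - 2 * `|x| ^+ n| <= e.
  by move: e e0; apply/cvgrPdist_le.
apply: filterS => n.
rewrite sub0r normrN ger0_norm ?mulr_ge0 ?exprn_ge0// => hn; apply: le_trans hn.
(* Multiplied by x, the partial sum becomes the Taylor polynomial of [- ln (1 - x)], so the
   logarithmic estimate applies with one more power of [|x|]. *)
rewrite -(ler_pM2r (_ : 0 < `|x|)) ?normr_gt0// -mulrA -exprSr.
apply: (le_trans _ (norm_ln1B_sub_taylor _ _ n xhalf)).
rewrite -normrM mulrBl divfK// -opprD normrN.
suff -> : series (fun j => x ^+ j / j.+1%:R) n * x =
  \sum_(j < n) x ^+ j.+1 / j.+1%:R by [].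
by rewrite seriesEord/= mulr_suml; apply: eq_bigr => j _; rewrite exprSr mulrAC.
Unshelve. all: end_near. Qed.

(* Coefficient of X^m in (\sum_j X^j / (j+1))^k. *)
Fixpoint log_power_coef (R : realType) (k m : nat) : R :=
  if k is k'.+1 then \sum_(j < m.+1) log_power_coef R k' (m - j) * j.+1%:R^-1
  else (m == 0)%:R.

(** Induction on k, each step being a Cauchy product with the series of [neg_ln1B_div]. Absolute
    convergence is carried along because the product theorem requires it of both factors. *)
Lemma cvg_series_log_power (R : realType) (x : R) (k : nat) : `|x| <= 2^-1 ->
  cvgn [normed series (fun m => log_power_coef R k m * x ^+ m)] /\
  series (fun m => log_power_coef R k m * x ^+ m) @ \oo --> neg_ln1B_div x ^+ k.
Proof.
move=> xhalf; have x1 : `|x| < 1 by lra.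
elim: k => [|k [IHn IH]] /=.
  have -> : (fun m => (m == 0)%:R * x ^+ m) = (fun m => (m == 0)%:R).
    by apply/funext => -[|m]; rewrite ?mul0r ?mulr1.
  have s1 : series (fun m : nat => (m == 0)%:R : R) @ \oo --> (1 : R).
    rewrite -(cvg_shiftn 1); apply: cvg_near_cst; near=> n.
    by rewrite /= addn1 seriesEord/= big_ord_recl/= big1 ?addr0.
  split; last exact: s1.
  suff -> : [normed series (fun m : nat => (m == 0)%:R : R)] =
    series (fun m : nat => (m == 0)%:R : R) by exact: cvgP s1.
  by congr series; apply/funext => m; rewrite /= normr_nat.
have -> : (fun m => (\sum_(j < m.+1) log_power_coef R k (m - j) * j.+1%:R^-1) *
      x ^+ m) =
    cauchy_product (fun m => log_power_coef R k m * x ^+ m)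
      (fun j => x ^+ j / j.+1%:R).
  apply/funext => m; rewrite /cauchy_product mulr_suml; apply: eq_bigr => j _.
  have jm : (j <= m)%N by rewrite -ltnS.
  have -> : x ^+ m = x ^+ (m - j) * x ^+ j by rewrite -exprD subnK.
  by ring.
have h := is_cvg_normed_series_geometric_div _ _ x1.
split; first exact: is_cvg_normed_cauchy_product.
by rewrite exprSr; apply: cvg_cauchy_product => //; exact: cvg_series_geometric_div.
Unshelve. all: end_near. Qed.

(** This is n! times the coefficient of t^n in [(t L(- lambda t))^k / k!], where L is the series of
    [neg_ln1B_div]. *)
Definition stirling1_coef {R : realType} (lambda : R) (k n : nat) : R :=
  if (k <= n)%N then
    (- lambda) ^+ (n - k) * (n`!%:R / k`!%:R) * log_power_coef R k (n - k)
  else 0.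

(** The value 1 of [neg_ln1B_div] at 0 covers both [lambda = 0], where the logarithm is t by
    convention, and [t = 0], where both sides vanish. *)
Lemma degenerate_logE (R : realType) (lambda t : R) : `|- lambda * t| <= 2^-1 ->
  degenerate_log lambda t = t * neg_ln1B_div (- lambda * t).
Proof.
move=> lt_half; rewrite /degenerate_log /neg_ln1B_div mulf_eq0 oppr_eq0.
case: eqP => [_|/eqP l0]/=; first by rewrite mulr1.
case: eqP => [->|/eqP t0]; first by rewrite mulr0 addr0 powR1 ln1 mul0r.
have -> : 1 - - lambda * t = 1 + lambda * t by ring.
by rewrite ln_powR; field; rewrite l0 t0.
Qed.

Lemma stirling1_coef_egf (R : realType) (lambda : R) (k : nat) :
  degenerate_stirling1_egf lambda k (stirling1_coef lambda k).
Proof.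
split=> [n nk|]; first by rewrite /stirling1_coef leqNgt nk.
have near_half : \forall t \near (0 : R), `|- lambda * t| <= 2^-1.
  have : - lambda * t @[t --> (0 : R)] --> (0 : R).
    rewrite -[X in _ --> X](mulr0 (- lambda)).
    by apply: cvgM; [exact: cvg_cst|exact: cvg_id].
  by move/cvgr0_norm_le; apply; lra.
near=> t.
have lt_half : `|- lambda * t| <= 2^-1 by near: t.
rewrite degenerate_logE//.
have [_ cv] := cvg_series_log_power R (- lambda * t) k lt_half.
rewrite exprMn mulrA.
(* The factor t^k shifts exponents by k: the sum over [k <= n < N] corresponds to the first [N - k]
   terms of the series of L^k. *)
rewrite -(cvg_centern k) in cv.
apply: cvg_trans (cvgM (cvg_cst (k`!%:R^-1 * t ^+ k)) cv).
apply: near_eq_cvg; near=> N => /=.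
have kN : (k <= N)%N by near: N; exact: nbhs_infty_ge.
rewrite -[X in \sum_(X <= _ < _) _](add0n k) big_addn /series/= mulr_sumr.
apply: eq_bigr => m _; rewrite /stirling1_coef leq_addl addnK exprMn exprD.
by field; rewrite !pnatr_eq0 -!lt0n !fact_gt0.
Unshelve. all: end_near. Qed.

(** * Uniqueness of power series coefficients *)

Lemma sum_expr_le2 (R : realFieldType) (q : R) (n : nat) :
  0 <= q <= 2^-1 -> \sum_(i < n) q ^+ i <= 2.
Proof.
move=> /andP[q0 q_half].
rewrite -(ler_pM2l (_ : 0 < 1 - q)); last by lra.
have -> : (1 - q) * \sum_(i < n) q ^+ i = 1 - q ^+ n.
  by have := subrX1 q n; lra.
by have := exprn_ge0 n q0; lra.
Qed.

(** If [d m] were the first nonzero coefficient, the term [d m * t^m] would have to be cancelled by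
    a tail of order t^(m+1), which is impossible for small positive t. *)
Lemma power_series_near0_inj (R : realType) (d : nat -> R) :
  (\forall t \near (0 : R), series (fun n => d n * t ^+ n) @ \oo --> (0 : R)) ->
  forall n, d n = 0.
Proof.
move=> [r /= r0 dr] m.
pose rho := r / 2.
have rho0 : 0 < rho by rewrite /rho divr_gt0.
have cvg_t (t : R) : 0 <= t <= rho ->
    series (fun n => d n * t ^+ n) @ \oo --> (0 : R).
  move=> /andP[t0 tr]; apply: dr => /=.
  by rewrite sub0r normrN ger0_norm//; move: tr; rewrite /rho; lra.
(* The terms of the convergent series at [rho] tend to 0, hence are bounded; the maximum with 1
   makes the bound positive. *)
have [M M0 dM] : exists2 M, 0 < M & forall n, `|d n| * rho ^+ n <= M.
  have cv : cvgn (fun n => d n * rho ^+ n).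
    apply: (@cvgP _ _ (0 : R)); apply: cvg_series_cvg_0.
    by apply: cvgP; apply: cvg_t; rewrite lexx ltW.
  have [M [_ HM]] := cvg_seq_bounded cv.
  exists (Num.max (M + 1) 1); first by rewrite lt_max ltr01 orbT.
  move=> n; rewrite le_max; apply/orP; left.
  have := HM (M + 1) _ n Logic.I; rewrite /= normrM (ger0_norm (exprn_ge0 _ (ltW rho0))).
  by apply; rewrite ltrDl.
elim/ltn_ind: m => m IH; apply/eqP/negPn/negP => dm0.
have norm0 : 0 < `|d m| by rewrite normr_gt0.
(* The tail is dominated by M times a geometric series of ratio [t / rho]; the restriction
   [t <= rho / 2] makes its sum at most 2. *)
have bound (t : R) : 0 < t <= rho / 2 -> `|d m| * t ^+ m <= 2 * M * (t / rho) ^+ m.+1.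
  move=> /andP[t0 t_half].
  have q0 : 0 <= t / rho <= 2^-1.
    by apply/andP; split; [rewrite divr_ge0 ?ltW|rewrite ler_pdivrMr// mulrC].
  apply/ler_addgt0Pl => e e0.
  have : \forall N \near \oo, `|series (fun n => d n * t ^+ n) N| <= e.
    move: e e0; apply/cvgr0_norm_le; apply: cvg_t.
    by rewrite ltW//=; move: t_half; lra.
  move=> [N0 _ /(_ (m.+1 + N0)%N)]/= /(_ (leq_addl _ _)).
  rewrite seriesEord/= big_split_ord/= big_ord_recr/= big1 ?add0r; last first.
    by move=> i _; rewrite IH// mul0r.
  set S := \sum_(i < N0) _ => hS.
  have SM : `|S| <= 2 * M * (t / rho) ^+ m.+1.
    apply: le_trans (ler_norm_sum _ _ _) _.
    apply: (@le_trans _ _ (\sum_(i < N0) M * (t / rho) ^+ m.+1 * (t / rho) ^+ i)).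
      apply: ler_sum => i _.
      rewrite normrM normrX (gtr0_norm t0) -mulrA -exprD expr_div_n mulrA.
      by rewrite ler_pdivlMr ?exprn_gt0// mulrAC ler_wpM2r ?dM ?exprn_ge0 ?ltW.
    rewrite -mulr_sumr -[leRHS]mulrA [leRHS]mulrC ler_wpM2l ?sum_expr_le2//.
    by case/andP: q0 => ? _; rewrite mulr_ge0 ?exprn_ge0// ltW.
  have := ler_normB (d m * t ^+ m + S) S; rewrite addrK normrM normrX (gtr0_norm t0).
  by move=> h; apply: le_trans h _; rewrite lerD.
(* For [t <= c] the inequality [bound], divided by t^m, would give [|d m| <= |d m| / 2]. *)
pose c := `|d m| * rho ^+ m.+1 / (4 * M).
have c0 : 0 < c by rewrite /c divr_gt0 ?mulr_gt0 ?exprn_gt0.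
pose t := Num.min (rho / 2) c.
have t0 : 0 < t by rewrite lt_min c0 divr_gt0.
have tM : t * (4 * M) <= `|d m| * rho ^+ m.+1.
  by rewrite -ler_pdivlMr ?mulr_gt0// ge_min lexx orbT.
have /bound : 0 < t <= rho / 2 by rewrite t0 ge_min lexx.
have -> : 2 * M * (t / rho) ^+ m.+1 = 2 * M * t / rho ^+ m.+1 * t ^+ m.
  by rewrite expr_div_n exprS; ring.
rewrite ler_pM2r ?exprn_gt0// ler_pdivlMr ?exprn_gt0//.
have : 0 < `|d m| * rho ^+ m.+1 by rewrite mulr_gt0 ?exprn_gt0.
by lra.
Qed.

Lemma degenerate_stirling1_egf_inj (R : realType) (lambda : R) (k : nat)
    (a b : nat -> R) :
  degenerate_stirling1_egf lambda k a -> degenerate_stirling1_egf lambda k b ->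
  a = b.
Proof.
move=> [a0 ha] [b0 hb]; apply/funext => n.
suff : (a n - b n) / n`!%:R = 0.
  move=> /eqP; rewrite mulf_eq0 invr_eq0 pnatr_eq0 eqn0Ngt fact_gt0 orbF.
  by rewrite subr_eq0 => /eqP.
move: n; apply: power_series_near0_inj; near=> t.
have ta : \sum_(k <= n < N) a n * (t ^+ n / n`!%:R) @[N --> \oo] -->
    k`!%:R^-1 * degenerate_log lambda t ^+ k by near: t.
have tb : \sum_(k <= n < N) b n * (t ^+ n / n`!%:R) @[N --> \oo] -->
    k`!%:R^-1 * degenerate_log lambda t ^+ k by near: t.
have tab : \sum_(k <= n < N) a n * (t ^+ n / n`!%:R) -
    \sum_(k <= n < N) b n * (t ^+ n / n`!%:R) @[N --> \oo] --> (0 : R).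
  rewrite -[X in _ --> X](subrr (k`!%:R^-1 * degenerate_log lambda t ^+ k)).
  exact: (cvgB ta tb).
apply: cvg_trans tab.
apply: near_eq_cvg; near=> N => /=.
have kN : (k <= N)%N by near: N; exact: nbhs_infty_ge.
rewrite -sumrB /series/= [RHS](big_cat_nat _ kN)//=.
(* The full power series also has terms of index below k; they vanish because both sequences are 0
   there. *)
rewrite [X in _ = X + _]big_nat [X in _ = X + _]big1 ?add0r.
  by apply: eq_bigr => n _; ring.
by move=> n /andP[_ nk]; rewrite a0// b0// subrr !mul0r.
Unshelve. all: end_near. Qed.

Lemma degenerate_stirling1E (R : realType) (lambda : R) (n k : nat) :
  degenerate_stirling1 lambda n k = stirling1_coef lambda k n.
Proof.
rewrite /degenerate_stirling1 (@xget_unique _ _ _ (stirling1_coef lambda k))//.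
  exact: stirling1_coef_egf.
move=> b /degenerate_stirling1_egf_inj; apply; exact: stirling1_coef_egf.
Qed.

(** * Expectation of products *)

Section ge0_integral_change.
Context {d d' : measure_display} {T : measurableType d} {T' : measurableType d'}
  {R : realType} (mu : {measure set T -> \bar R}) (nu : {measure set T' -> \bar R})
  (Y : T -> R) (Z : T -> T') (c : R).
Hypotheses (mY : measurable_fun [set: T] Y) (Y0 : forall x, 0 <= Y x)
  (mZ : measurable_fun [set: T] Z) (c0 : 0 <= c)
  (indicE : forall A, measurable A ->
    (\int[mu]_x (Y x * \1_A (Z x))%:E = c%:E * nu A)%E).

Import HBNNSimple.

(** A simple function is a finite combination of indicators of its fibres, to which [indicE]
    applies. *)
Let integral_change_nnsfun (f : {nnsfun T' >-> R}) :
  (\int[mu]_x (Y x * f (Z x))%:E = c%:E * \int[nu]_y (f y)%:E)%E.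
Proof.
have m1 (r : R) : measurable (f @^-1` [set r]) by exact: measurable_sfunP.
have f_ge0 (r : R) y : 0 <= r * \1_(f @^-1` [set r]) y.
  by have := nnfun_muleindic_ge0 f r y; rewrite -EFinM lee_fin.
have mYf (r : R) : measurable_fun [set: T] (fun x => Y x * \1_(f @^-1` [set r]) (Z x)).
  by apply: measurable_funM => //; exact: measurableT_comp.
transitivity (\int[mu]_x (\sum_(r \in range f)
    (r * (Y x * \1_(f @^-1` [set r]) (Z x)))%:E))%E.
  apply: eq_integral => x _; rewrite [in LHS]fimfunE EFinM -fsumEFin//.
  rewrite ge0_mule_fsumr; last by move=> r; rewrite lee_fin f_ge0.
  by apply: eq_fsbigr => r _; rewrite -EFinM mulrCA.
rewrite ge0_integral_fsum//; last 2 first.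
  - by move=> r; apply/measurable_EFinP/measurable_funM.
  - by move=> r x _; rewrite lee_fin mulrCA mulr_ge0.
rewrite integralT_nnsfun sintegralE ge0_mule_fsumr; last first.
  by move=> r; exact: nnsfun_mulemu_ge0.
apply: eq_fsbigr => r _; rewrite muleCA -indicE//.
have [r0|r0] := leP 0 r.
  under eq_integral do rewrite EFinM.
  rewrite ge0_integralZl//; first exact/measurable_EFinP.
  by move=> x _; rewrite lee_fin mulr_ge0.
(* A negative value has an empty fibre, so both sides are 0. *)
rewrite preimage_nnfun0//.
by rewrite !integral0_eq ?mule0// => x _; rewrite indic0 !mulr0.
Qed.

(** Extends [indicE] from indicators through simple functions to nonnegative measurable functions by
    monotone convergence. It serves twice: for independence, with [Y] the product of the other
    factors, and for densities, with [Y] the density and [Z] the identity. *)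
Lemma ge0_integral_change (f : T' -> R) : measurable_fun [set: T'] f ->
  (forall y, 0 <= f y) ->
  (\int[mu]_x (Y x * f (Z x))%:E = c%:E * \int[nu]_y (f y)%:E)%E.
Proof.
move=> mf f0.
have mEf : measurable_fun [set: T'] (EFin \o f) by exact/measurable_EFinP.
have Ef0 y : [set: T'] y -> (0 <= (EFin \o f) y)%E by rewrite lee_fin.
pose f_ := nnsfun_approx measurableT mEf.
have mYf n : measurable_fun [set: T] (fun x => Y x * f_ n (Z x)).
  by apply: measurable_funM => //; exact: measurableT_comp.
have nd_f y : {homo (fun n => f_ n y) : n m / (n <= m)%N >-> n <= m}.
  by move=> n m nm; exact/lefP/nd_nnsfun_approx.
transitivity (lim (\int[mu]_x (Y x * f_ n (Z x))%:E @[n --> \oo])%E).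
  rewrite -monotone_convergence//=.
  - apply: eq_integral => x _; apply/esym/cvg_lim => //=.
    under eq_fun do rewrite EFinM.
    by rewrite EFinM; apply: cvgeZl => //; exact: cvg_nnsfun_approx.
  - by move=> n; exact/measurable_EFinP.
  - by move=> n x _; rewrite lee_fin mulr_ge0.
  - by move=> x _ n m nm; rewrite lee_fin ler_wpM2l// nd_f.
have -> : (\int[nu]_y (f y)%:E = lim (\int[nu]_y (f_ n y)%:E @[n --> \oo]))%E.
  rewrite -monotone_convergence//=.
  - apply: eq_integral => y _; apply/esym/cvg_lim => //=.
    exact: (cvg_nnsfun_approx measurableT mEf Ef0).
  - by move=> n; exact/measurable_EFinP/measurable_funTS.
  - by move=> n y _; rewrite lee_fin.
  - by move=> y _ n m nm; rewrite lee_fin nd_f.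
rewrite -limeMl//.
  by apply: congr_lim; apply/funext => n /=; exact: integral_change_nnsfun.
apply/ereal_nondecreasing_is_cvgn => n m nm; apply: ge0_le_integral => //=.
- by move=> ? _; rewrite lee_fin.
- exact/measurable_EFinP/measurable_funTS.
- exact/measurable_EFinP/measurable_funTS.
- by move=> ? _; rewrite lee_fin nd_f.
Qed.

End ge0_integral_change.

Section independent_product.
Context {d : measure_display} {T : measurableType d} {R : realType}
  (P : probability T R) {I : finType} (Z : I -> {RV P >-> R}).
Hypothesis indepZ : mutually_independent Z.

Let mZ i A : measurable A -> measurable (Z i @^-1` A).
Proof. by move=> mA; rewrite -[X in measurable X]setTI; exact: measurable_funPT. Qed.

Let integral_indicZ i A : measurable A ->
  (\int[P]_x (\1_A (Z i x))%:E = P (Z i @^-1` A))%E.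
Proof.
move=> mA; transitivity (\int[P]_x (\1_(Z i @^-1` A) x)%:E)%E; first by [].
by rewrite integral_indic ?setIT//; exact: mZ.
Qed.

(** Independence is the case where all factors are indicators; [ge0_integral_change] then frees one
    factor at a time. *)
Lemma integral_prod_indep (g : I -> R -> R) (v : I -> R) :
  (forall i, measurable_fun [set: R] (g i)) -> (forall i y, 0 <= g i y) ->
  (forall i, (\int[P]_x (g i (Z i x))%:E = (v i)%:E)%E) ->
  (\int[P]_x (\prod_i g i (Z i x))%:E = (\prod_i v i)%:E)%E.
Proof.
have : forall i, i \notin enum I -> exists2 A, measurable A & g i = \1_A.
  by move=> i; rewrite mem_enum.
(* Induction on the list of the indices at which g is not an indicator. *)
elim: (enum I) g v => [|i l IH] g v gind mg g0 gv.
  have /choice[A HA] : forall i, exists A, measurable A /\ g i = \1_A.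
    by move=> i; have [A mA gA] := gind i isT; exists A.
  have mA i : measurable (Z i @^-1` A i).
    by apply: mZ; exact: (HA i).1.
  have vE i : P (Z i @^-1` A i) = (v i)%:E.
    by rewrite -gv (HA i).2 integral_indicZ//; exact: (HA i).1.
  transitivity (\int[P]_x
      (\1_(\bigcap_(i in [set` [set: I]%SET]) (Z i @^-1` A i)) x)%:E)%E.
    apply: eq_integral => x _; congr EFin.
    have [xA|xA] := pselect ((\bigcap_(i in [set` [set: I]%SET]) (Z i @^-1` A i)) x).
      rewrite [RHS]indicE mem_set// big1// => i _.
      by rewrite (HA i).2 indicE mem_set//; apply: xA; rewrite /= finset.inE.
    rewrite [RHS]indicE memNset//; apply/eqP/prodf_eq0.
    have [i Ai] : exists i, ~ A i (Z i x).
      by apply/existsNP => h; apply: xA => i _; exact: h.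
    by exists i => //; rewrite (HA i).2 indicE memNset.
  rewrite integral_indic//; last first.
    by apply: fin_bigcap_measurable => // i _; exact: mA.
  rewrite setIT.
  transitivity (\prod_(i in [set: I]%SET) P (Z i @^-1` A i))%E.
    by apply: indepZ => i; exact: (HA i).1.
  rewrite -prodEFin; apply: eq_big => [i|i _]; first by rewrite finset.inE.
  exact: vE.
pose Y x := \prod_(j | j != i) g j (Z j x).
have v0 j : 0 <= v j.
  by rewrite -lee_fin -gv; apply: integral_ge0 => x _; rewrite lee_fin.
have mY : measurable_fun [set: T] Y.
  apply: (@eq_measurable_fun _ _ _ _ _
    (fun x => \prod_(j <- enum [pred j | j != i]) g j (Z j x))).
    by move=> x _; rewrite /Y big_enum; apply: eq_bigl => j; rewrite inE.
  by apply: measurable_prod => j _; exact: measurableT_comp.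
transitivity (\int[P]_x (Y x * g i (Z i x))%:E)%E.
  by apply: eq_integral => x _; rewrite (bigD1 i)//= mulrC.
rewrite (ge0_integral_change P (distribution P (Z i)) Y (Z i) (\prod_(j | j != i) v j))//.
- rewrite ge0_integral_distribution//=; last 2 first.
  + exact/measurable_EFinP.
  + by move=> y; rewrite lee_fin.
  by rewrite gv -EFinM [in RHS](bigD1 i)//= mulrC.
- by move=> x; rewrite /Y; apply: prodr_ge0.
move=> A mA.
have PA : P (Z i @^-1` A) \is a fin_num by apply: fin_num_measure; exact: mZ.
(* With [g i] replaced by the indicator of [A], the index i leaves the list and the induction
   hypothesis yields what [ge0_integral_change] requires. *)
pose g' j := if j == i then \1_A else g j.
pose v' j := if j == i then fine (P (Z i @^-1` A)) else v j.
have := IH g' v'.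
have -> : (\int[P]_x (\prod_j g' j (Z j x))%:E = \int[P]_x (Y x * \1_A (Z i x))%:E)%E.
  apply: eq_integral => x _; rewrite (bigD1 i)//= /g' eqxx mulrC; congr (_ * _)%:E.
  by apply: eq_bigr => j /negPf ->.
have -> : \prod_j v' j = (\prod_(j | j != i) v j) * fine (P (Z i @^-1` A)).
  rewrite (bigD1 i)//= /v' eqxx mulrC; congr (_ * _).
  by apply: eq_bigr => j /negPf ->.
rewrite EFinM fineK//; apply.
- move=> j jl; rewrite /g'; case: eqP => [_|/eqP ji]; first by exists A.
  by apply: gind; rewrite inE negb_or ji.
- by move=> j; rewrite /g'; case: ifP.
- by move=> j y; rewrite /g'; case: ifP.
move=> j; rewrite /g' /v'; case: eqP => [->|_]; last exact: gv.
by rewrite fineK// integral_indicZ.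
Qed.

End independent_product.

(** * Moments *)

Lemma cvg_exprn_expRN (R : realType) (n : nat) :
  x ^+ n * expR (- x) @[x --> +oo] --> (0 : R).
Proof.
apply/cvgrPdist_le => e e0; near=> x.
have x0 : 0 < x by near: x; exact: nbhs_pinfty_gt.
rewrite sub0r normrN ger0_norm; last by rewrite mulr_ge0 ?exprn_ge0 ?expR_ge0 ?ltW.
rewrite expRN ler_pdivrMr ?expR_gt0//.
(* Since [expR x >= x^(n+1) / (n+1)!], the function is at most [(n+1)! / x], hence at most e beyond
   this threshold. *)
have fx : n.+1`!%:R / e <= x by near: x; apply: nbhs_pinfty_ge; rewrite num_real.
have f0 : 0 < n.+1`!%:R :> R by rewrite ltr0n fact_gt0.
have := expR_ge1Dxn n (ltW x0); rewrite -(ler_pM2l e0).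
apply: le_trans; rewrite mulrDr mulr1 ler_wpDl//; first exact: ltW.
rewrite mulrA ler_pdivlMr// exprS mulrA mulrC.
rewrite ler_wpM2r//; first by rewrite exprn_ge0 ?ltW.
by move: fx; rewrite ler_pdivrMr// mulrC.
Unshelve. all: end_near. Qed.

(* The polynomial q such that q - q' = X^n, so that - q e^(-x) is an
   antiderivative of x^n e^(-x). *)
Fixpoint gamma_poly (R : realType) (n : nat) : {poly R} :=
  if n is m.+1 then 'X^n + n%:R *: gamma_poly R m else 1.

Lemma gamma_poly_sub_deriv (R : realType) (n : nat) :
  gamma_poly R n - (gamma_poly R n)^`() = 'X^n.
Proof.
elim: n => [|n IH]; first by rewrite /= derivC subr0.
rewrite /= derivD derivXn derivZ /= scaler_nat.
rewrite scaler_nat -[X in _ = X]addr0 -(subrr (n.+1%:R *: 'X^n)) -{1}IH.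
by rewrite !scaler_nat mulrnBl; ring.
Qed.

Lemma horner_gamma_poly0 (R : realType) (n : nat) :
  (gamma_poly R n).[0] = n`!%:R.
Proof.
elim: n => [|n IH]; first by rewrite /= hornerC.
by rewrite /= hornerD hornerXn expr0n/= add0r hornerZ IH factS natrM.
Qed.

Lemma cvg_gamma_poly_expRN (R : realType) (n : nat) :
  (gamma_poly R n).[x] * expR (- x) @[x --> +oo] --> (0 : R).
Proof.
elim: n => [|n IH].
  apply: cvg_trans (@cvg_exprn_expRN R 0).
  by apply: near_eq_cvg; near=> x; rewrite /= hornerC expr0.
have h : x ^+ n.+1 * expR (- x) + n.+1%:R * ((gamma_poly R n).[x] * expR (- x))
    @[x --> +oo] --> (0 : R).
  rewrite -[X in _ --> X]addr0 -[X in _ --> _ + X](mulr0 (n.+1%:R)).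
  by apply: cvgD; [exact: cvg_exprn_expRN|apply: cvgM IH; exact: cvg_cst].
apply: cvg_trans h; apply: near_eq_cvg; near=> x.
by rewrite /= hornerD hornerXn hornerZ; ring.
Unshelve. all: end_near. Qed.

(** The antiderivative [F] tends to 0 at infinity and equals [- n!] at 0. *)
Lemma integral_exprn_expRN (R : realType) (n : nat) :
  (\int[lebesgue_measure]_(x in `[0%R, +oo[) (x ^+ n * expR (- x))%:E =
   n`!%:R%:E :> \bar R)%E.
Proof.
pose F (x : R) := - ((gamma_poly R n).[x] * expR (- x)).
have dF (x : R) : is_derive x 1 F (x ^+ n * expR (- x)).
  have h1 : is_derive x 1 (fun y : R => expR (- y)) (- expR (- x)).
    have h := @is_derive1_comp R expR (fun y : R => - y) x _ _
      (is_derive_expR _) (is_deriveNid _ _).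
    by rewrite -mulrN1; exact: h.
  have -> : F = - ((fun y : R => (gamma_poly R n).[y]) * (fun y : R => expR (- y))) by [].
  apply: is_derive_eq.
  rewrite /GRing.scale/=.
  have := congr1 (fun p => p.[x]) (gamma_poly_sub_deriv R n).
  by rewrite hornerD hornerN hornerXn => <-; ring.
rewrite (@ge0_continuous_FTC2y _ _ F _ 0).
- by rewrite /F oppr0 expR0 mulr1 horner_gamma_poly0 sub0e EFinN oppeK.
- by move=> x x0; rewrite mulr_ge0 ?exprn_ge0 ?expR_ge0.
- apply: continuous_subspaceT => x; apply: cvgM; first exact: exprn_continuous.
  apply: continuous_comp; last exact: continuous_expR.
  exact: opp_continuous.
- by rewrite -oppr0; apply: cvgN; exact: cvg_gamma_poly_expRN.
- by move=> x _; exact: ex_derive.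
- apply: cvg_at_right_filter; apply: differentiable_continuous.
  by apply/derivable1_diffP; exact: ex_derive.
- by move=> x _; rewrite derive1E; exact: derive_val.
Qed.

Lemma integral_exprn01 (R : realType) (n : nat) :
  (\int[lebesgue_measure]_(x in `[0%R, 1%R]) (x ^+ n)%:E =
   n.+1%:R^-1%:E :> \bar R)%E.
Proof.
pose F (x : R) := n.+1%:R^-1 * x ^+ n.+1.
have dF (x : R) : is_derive x 1 F (x ^+ n).
  have -> : F = (n.+1%:R^-1 : R) *: (@idfun R ^+ n.+1).
    by apply/funext => z; rewrite scalrfctE exprfctE.
  by apply: is_derive_eq; rewrite /GRing.scale/= mulr1 mulrA mulVf ?mul1r.
have cF : continuous F.
  move=> x; apply: differentiable_continuous.
  by apply/derivable1_diffP; exact: ex_derive.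
rewrite (@continuous_FTC2 _ _ F)//.
- by rewrite /F expr1n mulr1 expr0n/= mulr0 sube0.
- by apply: continuous_subspaceT => x; exact: exprn_continuous.
- split; first by move=> x _; exact: ex_derive.
  + exact: cvg_at_right_filter (cF _).
  + exact: cvg_at_left_filter (cF _).
- by move=> x _; rewrite derive1E; exact: derive_val.
Qed.

(** * Laws with a density and their absolute moments *)

Section law_with_density.
Context {d : measure_display} {T : measurableType d} {R : realType}
  {P : probability T R} (X : {RV P >-> R}) (p : R -> R).
Hypotheses (mp : measurable_fun [set: R] p) (p0 : forall x, 0 <= p x)
  (lawX : has_law X (fun A => \int[lebesgue_measure]_(x in A) (p x)%:E)%E).

Lemma ge0_integral_density (f : R -> R) :
  measurable_fun [set: R] f -> (forall y, 0 <= f y) ->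
  (\int[P]_w (f (X w))%:E = \int[lebesgue_measure]_x (p x * f x)%:E)%E.
Proof.
move=> mf f0.
rewrite (ge0_integral_change lebesgue_measure (distribution P X) p idfun 1)//.
  rewrite mul1e ge0_integral_distribution//; first exact/measurable_EFinP.
  exact: measurable_id.
move=> A mA; rewrite mul1e [RHS]lawX// [RHS]integral_mkcond.
apply: eq_integral => x _; rewrite patchE indicE.
by case: ifP => _; rewrite ?mulr1 ?mulr0.
Qed.

(** Nonnegativity holds only almost surely, which suffices to replace each variable by its absolute
    value under an expectation. *)
Lemma ae_ge0_density : (forall x, x < 0 -> p x = 0) ->
  {ae P, forall w, 0 <= X w}.
Proof.
move=> pneg; exists (X @^-1` `]-oo, 0[%classic); split.
- by rewrite -[X in measurable X]setTI; exact: measurable_funPT.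
- rewrite -[LHS]/(distribution P X _) lawX//.
  apply: integral0_eq => x; rewrite /= in_itv/= => x0.
  by rewrite pneg.
- by move=> w /=; rewrite in_itv/= ltNge => /negP.
Qed.

End law_with_density.

Section exponential_uniform.
Context {d : measure_display} {T : measurableType d} {R : realType}
  {P : probability T R} (X : {RV P >-> R}).

Let m_norm_exprn (n : nat) : measurable_fun [set: R] (fun y : R => `|y| ^+ n).
Proof. by apply: measurable_funX; exact: normr_measurable. Qed.

(** The absolute value makes the integrand nonnegative everywhere, as [ge0_integral_density]
    requires; on the support of the density it changes nothing. *)
Lemma exponential_abs_moment (n : nat) : has_law X (exponential_prob 1) ->
  (\int[P]_w (`|X w| ^+ n)%:E = n`!%:R%:E)%E.
Proof.
move=> lawX.
rewrite (ge0_integral_density X (exponential_pdf 1) _ _ lawX (fun y => `|y| ^+ n))//.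
- rewrite -integral_exprn_expRN [RHS]integral_mkcond; apply: eq_integral => x _.
  rewrite /exponential_pdf !patchE; case: ifPn => [|_]; last by rewrite mul0r.
  rewrite inE/= in_itv/= andbT => x0.
  by rewrite ger0_norm// mul1r mulN1r mulrC.
- exact: measurable_exponential_pdf.
- by move=> x; exact: exponential_pdf_ge0.
Qed.

Lemma exponential_ae_ge0 : has_law X (exponential_prob 1) ->
  {ae P, forall w, 0 <= X w}.
Proof.
by move=> lawX; apply: (ae_ge0_density X _ lawX) => x; exact: lt0_exponential_pdf.
Qed.

Lemma uniform_abs_moment (n : nat) : has_law X (uniform_prob (@ltr01 R)) ->
  (\int[P]_w (`|X w| ^+ n)%:E = n.+1%:R^-1%:E)%E.
Proof.
move=> lawX.
rewrite (ge0_integral_density X (uniform_pdf 0 1) _ _ lawX (fun y => `|y| ^+ n))//.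
- rewrite -integral_exprn01 [RHS]integral_mkcond; apply: eq_integral => x _.
  rewrite /uniform_pdf patchE mem_setE in_itv/=; case: ifPn => [/andP[x0 _]|_].
    by rewrite ger0_norm// subr0 invr1 mul1r.
  by rewrite mul0r.
- exact: measurable_uniform_pdf.
- by move=> x; apply: uniform_pdf_ge0.
Qed.

Lemma uniform_ae_ge0 : has_law X (uniform_prob (@ltr01 R)) ->
  {ae P, forall w, 0 <= X w}.
Proof.
move=> lawX; apply: (ae_ge0_density X _ lawX) => x x0.
by rewrite /uniform_pdf leNgt x0.
Qed.

End exponential_uniform.

(** * Moments of a sum from its mixed moments *)

Section moments_of_sum.
Context {d : measure_display} {T : measurableType d} {R : realType}
  (mu : {measure set T -> \bar R}) {I : finType} (W : I -> T -> R).
Hypotheses (mW : forall i, measurable_fun [set: T] (W i))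
  (W0 : forall i x, 0 <= W i x)
  (moments : forall e : I -> nat,
    (\int[mu]_x (\prod_i W i x ^+ e i)%:E =
     (\prod_i ((e i)`!%:R / (e i).+1%:R))%:E)%E).

(** The monomial with exponents [e] makes the induction on [l] go through: it records the powers of
    the variables already split off the sum by the binomial formula. Since
    ['C(m, j) * j! * (m - j)! = m!], the factors [j! / (j + 1)] build up the convolution defining
    [log_power_coef]. *)
Lemma moment_sum (l : seq I) (m : nat) (e : I -> nat) :
  uniq l -> {in l, forall i, e i = 0%N} ->
  (\int[mu]_x ((\sum_(i <- l) W i x) ^+ m * \prod_i W i x ^+ e i)%:E =
   (m`!%:R * log_power_coef R (size l) m *
    \prod_i ((e i)`!%:R / (e i).+1%:R))%:E)%E.
Proof.
have mprod (u : I -> nat) : measurable_fun [set: T] (fun x => \prod_i W i x ^+ u i).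
  by apply: measurable_prod => i _; exact: measurable_funX.
elim: l m e => [m e _ _|i l IH m e /= /andP[il ul] e0].
  case: m => [|m] /=.
    by rewrite mulr1 mul1r -moments; apply: eq_integral => x _; rewrite mul1r.
  rewrite mulr0 mul0r; apply: integral0_eq => x _.
  by rewrite big_nil expr0n mul0r.
have msum n : measurable_fun [set: T] (fun x => (\sum_(i <- l) W i x) ^+ n).
  by apply: measurable_funX; exact: measurable_sum.
(* Splitting off [W i] to the power j sets its exponent, 0 so far, to j. *)
pose e' (j : nat) s := if s == i then j else e s.
have ei : e i = 0%N by apply: e0; rewrite inE eqxx.
have prod_e' (F : I -> nat -> R) j : F i 0%N = 1 ->
    \prod_s F s (e' j s) = F i j * \prod_s F s (e s).
  move=> F0; rewrite (bigD1 i)//= [in RHS](bigD1 i)//= ei F0 mul1r /e' eqxx.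
  by congr (_ * _); apply: eq_bigr => s /negPf ->.
transitivity (\int[mu]_x \sum_(j < m.+1) ('C(m, j)%:R%:E *
    ((\sum_(i <- l) W i x) ^+ (m - j) * \prod_s W s x ^+ e' j s)%:E))%E.
  apply: eq_integral => x _; under [RHS]eq_bigr do rewrite -EFinM.
  rewrite sumEFin; congr EFin.
  rewrite big_cons addrC exprDn mulr_suml; apply: eq_bigr => j _.
  by rewrite (prod_e' (fun s n => W s x ^+ n))// -mulr_natl; ring.
have pos x n u : 0 <= (\sum_(i <- l) W i x) ^+ n * \prod_s W s x ^+ u s.
  apply: mulr_ge0; first by apply: exprn_ge0; exact: sumr_ge0.
  by apply: prodr_ge0 => s _; exact: exprn_ge0.
have mpos n u : measurable_fun [set: T]
    (fun x => ((\sum_(i <- l) W i x) ^+ n * \prod_s W s x ^+ u s)%:E).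
  by apply/measurable_EFinP; exact: measurable_funM.
rewrite ge0_integral_sum//; last 2 first.
  - by move=> j; exact: measurable_funeM.
  - by move=> j x _; rewrite -EFinM lee_fin mulr_ge0.
under [LHS]eq_bigr => j _.
  rewrite ge0_integralZl_EFin//; last by move=> x _; rewrite lee_fin.
  rewrite IH//; last first.
    move=> s sl; rewrite /e' ifF; first by apply: e0; rewrite inE sl orbT.
    by apply: contraNF il => /eqP <-.
  rewrite (prod_e' (fun _ n => n`!%:R / n.+1%:R)) ?divr1//.
  over.
under [LHS]eq_bigr do rewrite -EFinM.
rewrite sumEFin; congr EFin.
rewrite mulr_sumr mulr_suml; apply: eq_bigr => j _.
have jm : (j <= m)%N by rewrite -ltnS.
have -> : m`!%:R = 'C(m, j)%:R * (j`!%:R * (m - j)`!%:R) :> R.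
  by rewrite -!natrM bin_fact.
by ring.
Qed.

End moments_of_sum.

(** * Comparison of the two sides *)

Theorem theorem5 (R : realType) (lambda : R) (k n : nat) (hkn : (k <= n)%N)
    (d : measure_display) (T : measurableType d) (P : probability T R)
    (X U : 'I_k -> {RV P >-> R})
    (hX : forall i, has_law (X i) (exponential_prob (1 : R)))
    (hU : forall i, has_law (U i) (uniform_prob (@ltr01 R)))
    (hXU : mutually_independent
      (fun s : 'I_k + 'I_k => match s with inl i => X i | inr j => U j end)) :
  ((degenerate_stirling1 lambda n k)%:E =
   ((- lambda) ^+ (n - k) * 'C(n, k)%:R)%:E *
   'E_P[(fun w => (\sum_(i < k) U i w * X i w) ^+ (n - k))%R])%E.
Proof.
(* Absolute values give the everywhere nonnegative summands required by [moment_sum]; they agree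
   with [U i * X i] almost surely. *)
pose W (i : 'I_k) w : R := `|U i w| * `|X i w|.
have mW i : measurable_fun [set: T] (W i).
  by apply: measurable_funM; apply: measurableT_comp.
have W0 i w : 0 <= W i w by rewrite mulr_ge0.
have moments (e : 'I_k -> nat) : (\int[P]_w (\prod_i W i w ^+ e i)%:E =
    (\prod_i ((e i)`!%:R / (e i).+1%:R))%:E)%E.
  (* Each power of [W i] splits into the same power of [|X i|] and of [|U i|], with moments [e!] and
     [1 / (e + 1)]; independence is applied to all 2k variables at once. *)
  pose expn s := match s with inl i => e i | inr i => e i end.
  pose v (s : 'I_k + 'I_k) : R :=
    match s with inl i => (e i)`!%:R | inr i => (e i).+1%:R^-1 end.
  have := integral_prod_indep P _ hXU (fun s y => `|y| ^+ expn s) v.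
  rewrite big_sumType/= -big_split/= => <-.
  - apply: eq_integral => w _; rewrite big_sumType/= -big_split/=.
    by congr EFin; apply: eq_bigr => i _; rewrite exprMn mulrC.
  - by move=> s; apply: measurable_funX; exact: normr_measurable.
  - by move=> s y; exact: exprn_ge0.
  - by move=> [i|i]; [exact: exponential_abs_moment|exact: uniform_abs_moment].
have mE m : ('E_P[(fun w => (\sum_(i < k) U i w * X i w) ^+ m)%R] =
    (m`!%:R * log_power_coef R k m)%:E)%E.
  (* All indices are summed and the monomial is trivial. *)
  have := moment_sum P W mW W0 moments (index_enum 'I_k) m (fun=> 0%N).
  rewrite index_enum_uniq => /(_ isT (fun _ _ => erefl)).
  rewrite [X in log_power_coef _ X](_ : _ = k); last first.
    by rewrite -[RHS](card_ord k) cardE enumT.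
  rewrite [X in _ = (_ * X)%:E]big1 ?mulr1; last by move=> i _; rewrite divr1.
  move=> <-; rewrite unlock; apply: ae_eq_integral => //.
  - apply/measurable_EFinP/measurable_funX/measurable_sum => i.
    by apply: measurable_funM.
  - apply/measurable_EFinP/measurable_funM.
      by apply: measurable_funX; exact: measurable_sum.
    by apply: measurable_prod => i _; exact: measurable_funX.
  have X0 : {ae P, forall w, forall i, 0 <= X i w}.
    by apply: filter_forall => i; exact: exponential_ae_ge0.
  have U0 : {ae P, forall w, forall i, 0 <= U i w}.
    by apply: filter_forall => i; exact: uniform_ae_ge0.
  apply: filterS2 X0 U0 => w X0 U0 _.
  rewrite [X in _ = (_ * X)%:E]big1 ?mulr1//.
  by congr (_ ^+ _)%:E; apply: eq_bigr => i _; rewrite /W !ger0_norm.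
rewrite mE degenerate_stirling1E /stirling1_coef hkn -EFinM; congr EFin.
have -> : n`!%:R = 'C(n, k)%:R * (k`!%:R * (n - k)`!%:R) :> R.
  by rewrite -!natrM bin_fact.
by field; rewrite pnatr_eq0 -lt0n fact_gt0.
Qed.
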